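(* Let $\Omega\subseteq\mathbb{R}$ be a domain, let $1\le p\le\infty$, fix a time $t$, and let $u(\cdot,t)\ge 0$ be a sufficiently smooth probability density on $\Omega$. Let $\Delta x>0$ and let $S_{\Delta x}\ge 0$ be a measurable smoothing function on $\mathbb{R}$ with $\int_\Omega S_{\Delta x}(x)\,dx=1$. Let $X_1,\dots,X_N$ be i.i.d. random variables with density $u(\cdot,t)$ and define $$u_{N,\Delta x}(x,t)=\frac1N\sum_{k=1}^N S_{\Delta x}(x-X_k),\qquad u_{\Delta x}(x,t)=\int_\Omega S_{\Delta x}(x-y)\,u(y,t)\,dy .$$ Assume that the smoothing has order of accuracy $q\ge 1$, i.e. $$\|u(\cdot,t)-u_{\Delta x}(\cdot,t)\|_{L^p(\Omega)}\le C_q(\Delta x)^q,$$ where the constant $C_q$ depends on the $q$-th derivative of $u(\cdot,t)$ and on the domain $\Omega$. Then $$\|u(\cdot,t)-u_{N,\Delta x}(\cdot,t)\|_{L^p(\Omega,L^2(\Omega))}\le \frac{\|\sigma_S(\cdot,t)\|_{L^p(\Omega)}}{N^{1/2}}+C_q(\Delta x)^q,$$ where $$\sigma_S^2(x,t)=\int_\Omega\big(S_{\Delta x}(x-y)-u_{\Delta x}(x,t)\big)^2\,u(y,t)\,dy .$$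
   Context: For a random function $g$ on $\Omega$ (depending on the random samples), the mixed norm is defined by $\|g\|_{L^p(\Omega,L^2(\Omega))}:=\big\|\,\mathbb{E}[g^2]^{1/2}\,\big\|_{L^p(\Omega)}$, where $\mathbb{E}$ is the expectation with respect to the random samples $X_1,\dots,X_N$ (the expectation is taken pointwise in $x\in\Omega$, then the $L^p$ norm in $x$ is taken). Norms are allowed to be $+\infty$. *)

(* Defs.v *)
From HB Require Import structures.
From mathcomp Require Import all_boot all_order all_algebra.
From mathcomp Require Import all_classical all_reals all_analysis.

Set Implicit Arguments.
Unset Strict Implicit.
Unset Printing Implicit Defensive.

Import Order.TTheory GRing.Theory Num.Theory.
Import numFieldNormedType.Exports.

Local Open Scope classical_set_scope.
Local Open Scope ring_scope.

Definition is_domain (R : realType) (D : set R) : Prop :=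
  [/\ D !=set0, open D & connected D].

(* The derivatives are two-sided; on an open set D they only depend on the
   values of f on D. *)
Definition times_derivable (R : realType) (D : set R) (q : nat)
    (f : R -> R) : Prop :=
  forall (k : nat) (x : R), (k < q)%N -> D x -> derivable (derive1n k f) x 1.

(* Densities on D are total functions whose values outside D are irrelevant. *)
Definition probability_density (R : realType) (D : set R) (f : R -> R) : Prop :=
  [/\ measurable_fun D f,
      (forall x, D x -> 0 <= f x) &
      (\int[lebesgue_measure]_(x in D) (f x)%:E = 1)%E].

Definition has_density (R : realType) (d : measure_display)
    (T : measurableType d) (P : probability T R) (D : set R) (f : R -> R)
    (X : {RV P >-> R}) : Prop :=
  forall A : set R, measurable A ->
    (distribution P X A = \int[lebesgue_measure]_(x in A `&` D) (f x)%:E)%E.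

Definition mutually_independent (R : realType) (d : measure_display)
    (T : measurableType d) (P : probability T R) (N : nat)
    (X : 'I_N -> {RV P >-> R}) : Prop :=
  forall (J : {set 'I_N}) (B : 'I_N -> set R), (forall i, measurable (B i)) ->
    (P (\bigcap_(i in [set i | i \in J]) (X i @^-1` B i)) =
     \prod_(i in J) P (X i @^-1` B i))%E.

(* The function is extended by 0 outside D, which leaves the norm over D
   unchanged, also for p = +oo. *)
Definition LpNorm (R : realType) (D : set R) (p : \bar R) (f : R -> \bar R)
    : \bar R :=
  ('N[lebesgue_measure]_p[f \_ D])%E.

Definition mixedNorm (R : realType) (d : measure_display)
    (T : measurableType d) (P : probability T R) (D : set R) (p : \bar R)
    (g : R -> T -> R) : \bar R :=
  LpNorm D p (fun x => sqrte 'E_P[fun w => (g x w ^+ 2)%R])%E.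

Definition empirical_density (R : realType) (d : measure_display)
    (T : measurableType d) (P : probability T R) (N : nat) (s : R -> R)
    (X : 'I_N -> {RV P >-> R}) (x : R) (w : T) : R :=
  N%:R^-1 * \sum_(k < N) s (x - X k w).

(* Extended-real valued: s is only assumed integrable on D, while x - y ranges
   over D - D, so the integral may be +oo. *)
Definition smoothed_density (R : realType) (D : set R) (s f : R -> R) (x : R)
    : \bar R :=
  (\int[lebesgue_measure]_(y in D) (s (x - y) * f y)%:E)%E.

Definition sigma2 (R : realType) (D : set R) (s f : R -> R) (x : R) : \bar R :=
  (\int[lebesgue_measure]_(y in D)
     (((s (x - y)%R)%:E - smoothed_density D s f x) ^+ 2 * (f y)%:E))%E.

Definition sigma (R : realType) (D : set R) (s f : R -> R) (x : R) : \bar R :=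
  sqrte (sigma2 D s f x).

(* Main.v *)
(* Fix x and write m for the smoothed density at x. Since the X_k have density
   u, each S(x - X_k) has mean m and variance sigma_S^2(x), and distinct terms
   are uncorrelated by independence (Fubini on the joint law of a pair). Hence
   E[(u - u_N)^2] = (u - m)^2 + sigma_S^2 / N, whose square root is at most
   sigma_S / sqrt N + |u - m|. Minkowski's inequality in L^p concludes. *)

Require Import Defs.
From HB Require Import structures.
From mathcomp Require Import all_boot all_order all_algebra.
From mathcomp Require Import all_classical all_reals all_analysis.
From mathcomp Require Import measurable_realfun ess_sup_inf ring.

Import Order.TTheory GRing.Theory Num.Theory.
Import numFieldNormedType.Exports.

Local Open Scope classical_set_scope.
Local Open Scope ring_scope.

(** * [L^p] norms of extended-real functions, [p = +oo] included *)

Section Lnorm.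
Context {d : measure_display} {T : measurableType d} {R : realType}.
Variable mu : {measure set T -> \bar R}.
Local Open Scope ereal_scope.
Implicit Types (f g : T -> \bar R) (p : \bar R).

Lemma measurable_abse_poweR f (r : R) : measurable_fun [set: T] f ->
  measurable_fun [set: T] (fun x => `|f x| `^ r).
Proof.
move=> mf; apply: (measurableT_comp (measurable_poweR _)).
exact: measurableT_comp.
Qed.

Lemma le_Lnorm f g p : 1 <= p ->
  measurable_fun [set: T] f -> measurable_fun [set: T] g ->
  (forall x, `|f x| <= `|g x|) -> 'N[mu]_p[f] <= 'N[mu]_p[g].
Proof.
move=> p1 mf mg fg; rewrite unlock /Lnorm; case: p p1 => [r| |//] p1.
- have r0 : (0 <= r)%R by rewrite lee_fin in p1; exact: le_trans p1.
  apply: gt0_ler_poweR; rewrite ?invr_ge0//.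
  + by rewrite in_itv/= leey andbT integral_ge0// => x _; exact: poweR_ge0.
  + by rewrite in_itv/= leey andbT integral_ge0// => x _; exact: poweR_ge0.
  + apply: ge0_le_integral => //.
    * by move=> x _; exact: poweR_ge0.
    * exact: measurable_abse_poweR.
    * exact: measurable_abse_poweR.
    * by move=> x _; apply: gt0_ler_poweR; rewrite ?in_itv/= ?leey ?andbT.
(* At [p = +oo] the norm is an essential supremum if the space has positive measure and 0 otherwise,
   hence the case split. *)
- by case: ifPn => // _; apply: le_ess_sup; exact: nearW.
Qed.

Lemma ae_eq_Lnorm f g p : 1 <= p ->
  measurable_fun [set: T] f -> measurable_fun [set: T] g ->
  (\forall x \ae mu, f x = g x) -> 'N[mu]_p[f] = 'N[mu]_p[g].
Proof.
move=> p1 mf mg fg; rewrite unlock /Lnorm; case: p p1 => [r| |//] p1.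
- congr (_ `^ _); apply: ae_eq_integral => //.
  + exact: measurable_abse_poweR.
  + exact: measurable_abse_poweR.
  + by apply: filterS fg => x /= ->.
- by case: ifPn => // _; apply: eq_ess_sup; apply: filterS fg => x /= ->.
Qed.

(** A finite norm makes [|f| ^ r] integrable, hence finite almost everywhere, and a finite power
    with [r] positive has a finite base. *)
Lemma Lnorm_lty_fin_num f (r : R) : (0 < r)%R -> measurable_fun [set: T] f ->
  'N[mu]_r%:E[f] < +oo -> \forall x \ae mu, f x \is a fin_num.
Proof.
move=> r0 mf Nf.
have : mu.-integrable setT (fun x => `|f x| `^ r).
  apply/integrableP; split; first exact: measurable_abse_poweR.
  under eq_integral do rewrite gee0_abs ?poweR_ge0//.
  by rewrite -poweR_Lnorm ?gt_eqF// poweR_lty.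
move/(integrable_ae measurableT); apply: filterS => x /= /(_ Logic.I).
rewrite ge0_fin_numE ?poweR_ge0// fin_num_abs.
by apply: lty_poweRy; rewrite gt_eqF.
Qed.

(** Minkowski is wanted for extended-real functions because [sigma] and the smoothed density may be
    infinite. When both norms are finite, the functions are finite almost everywhere and the
    real-valued inequality applies to their finite parts. *)
Lemma Lnorm_triangle f g p : 1 <= p ->
  measurable_fun [set: T] f -> measurable_fun [set: T] g ->
  'N[mu]_p[f \+ g] <= 'N[mu]_p[f] + 'N[mu]_p[g].
Proof.
case: p => [r| |//] p1 mf mg; last first.
  rewrite unlock /Lnorm; case: ifPn => // _; last by rewrite adde0.
  exact: ess_sup_absD.
have r0 : (0 < r)%R by rewrite lee_fin in p1; exact: lt_le_trans p1.
(* An infinite norm on the right settles the claim, since the other norm is nonnegative and their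
   sum is [+oo]. *)
have [->|Nf] := eqVneq 'N[mu]_r%:E[f] +oo.
  by rewrite addye ?leey// gt_eqF// (lt_le_trans _ (Lnorm_ge0 _ _ _)).
have [->|Ng] := eqVneq 'N[mu]_r%:E[g] +oo.
  by rewrite addey ?leey// gt_eqF// (lt_le_trans _ (Lnorm_ge0 _ _ _)).
have fE : \forall x \ae mu, f x = (fine (f x))%:E.
  apply: filterS (Lnorm_lty_fin_num _ _ r0 mf _); last by rewrite ltey.
  by move=> x /fineK.
have gE : \forall x \ae mu, g x = (fine (g x))%:E.
  apply: filterS (Lnorm_lty_fin_num _ _ r0 mg _); last by rewrite ltey.
  by move=> x /fineK.
have mf' : measurable_fun setT (fine \o f) by exact: measurableT_comp.
have mg' : measurable_fun setT (fine \o g) by exact: measurableT_comp.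
rewrite (ae_eq_Lnorm f (EFin \o (fine \o f)))//; last exact/measurable_EFinP.
rewrite (ae_eq_Lnorm g (EFin \o (fine \o g)))//; last exact/measurable_EFinP.
rewrite (ae_eq_Lnorm (f \+ g) (EFin \o ((fine \o f) \+ (fine \o g))%R))//.
- exact: minkowski_EFin.
- exact: emeasurable_funD.
- by apply/measurable_EFinP; exact: measurable_funD.
- by apply: filterS2 fE gE => x /= {1}-> {1}->.
Qed.

Lemma LnormZ_pos f (c : R) p : 1 <= p -> (0 < c)%R ->
  measurable_fun [set: T] f ->
  'N[mu]_p[(fun x => c%:E * f x)] = c%:E * 'N[mu]_p[f].
Proof.
case: p => [r| |//] p1 c0 mf; rewrite unlock /Lnorm.
- have r0 : (0 < r)%R by rewrite lee_fin in p1; exact: lt_le_trans p1.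
  under eq_integral.
    move=> x _; rewrite abseM/= gtr0_norm// poweRM ?lee_fin ?(ltW c0)//.
    over.
  rewrite ge0_integralZl//=; last 3 first.
  + exact: measurable_abse_poweR.
  + by move=> x _; exact: poweR_ge0.
  + by rewrite lee_fin powR_ge0.
  rewrite poweRM ?lee_fin ?powR_ge0//; last first.
    by apply: integral_ge0 => x _; exact: poweR_ge0.
  by rewrite /= -powRrM mulfV ?gt_eqF// powRr1 ?ltW.
- case: ifPn => [mu0|_]; last by rewrite mule0.
  rewrite -ess_supZl ?(ltW c0)//; apply: eq_ess_sup; apply: nearW => x /=.
  by rewrite abseM/= gtr0_norm.
Qed.

End Lnorm.

(** * Integration against a measure given by a density *)

Section density.
Context {d : measure_display} {T : measurableType d} {R : realType}.
Variables (mu nu : {measure set T -> \bar R}) (f : T -> R).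
Local Open Scope ereal_scope.
Import HBNNSimple.

(** Approximate [g] from below by simple functions and pass to the limit on both sides by monotone
    convergence. For a simple function the claim reduces to the hypothesis on its level sets. *)
Lemma ge0_integral_density (g : T -> \bar R) :
  measurable_fun [set: T] f -> (forall x, 0 <= f x)%R ->
  (forall A, measurable A -> nu A = \int[mu]_(x in A) (f x)%:E) ->
  measurable_fun [set: T] g -> (forall x, 0 <= g x) ->
  \int[nu]_x g x = \int[mu]_x (g x * (f x)%:E).
Proof.
move=> mf f0 nuE mg g0.
have mf' : measurable_fun setT (EFin \o f) by exact/measurable_EFinP.
pose h := nnsfun_approx measurableT mg.
have h_cvg x : (h n x)%:E @[n --> \oo] --> g x by exact: cvg_nnsfun_approx.
have h_nd x : nondecreasing_seq (fun n => (h n x)%:E).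
  by move=> a b ab; rewrite lee_fin; exact/lefP/nd_nnsfun_approx.
have mh n : measurable_fun setT (fun x => (h n x)%:E) by exact/measurable_EFinP.
transitivity (limn (fun n => \int[nu]_x (h n x)%:E)).
  rewrite -monotone_convergence//=.
  - by apply: eq_integral => x _; exact/esym/cvg_lim.
  - by move=> n x _; rewrite lee_fin.
transitivity (limn (fun n => \int[mu]_x ((h n x)%:E * (f x)%:E))); last first.
  rewrite -monotone_convergence//=.
  - by apply: eq_integral => x _; apply/cvg_lim => //; exact: cvgeZr.
  - by move=> n; exact: emeasurable_funM.
  - by move=> n x _; rewrite mule_ge0// lee_fin.
  - by move=> x _ a b ab; rewrite lee_wpmul2r ?lee_fin//; exact: h_nd.
congr (limn _); apply/funext => n.
have mA k : measurable (h n @^-1` [set k]) by exact: measurable_sfunP.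
have EFinh x : (h n x)%:E =
    \sum_(k \in range (h n)) k%:E * (\1_(h n @^-1` [set k]) x)%:E.
  by rewrite fimfunE -fsumEFin.
under eq_integral do rewrite EFinh.
rewrite ge0_integral_fsum//; last 2 first.
- by move=> k; apply: measurable_funeM; exact/measurable_EFinP.
- by move=> k x _; exact: nnfun_muleindic_ge0.
transitivity (\int[mu]_x (\sum_(k \in range (h n))
    k%:E * (\1_(h n @^-1` [set k]) x)%:E * (f x)%:E)); last first.
  apply: eq_integral => x _; rewrite EFinh !fsbig_finite//.
  by rewrite ge0_sume_distrl// => k _; exact: nnfun_muleindic_ge0.
rewrite ge0_integral_fsum//; last 2 first.
- move=> k; apply: emeasurable_funM => //.
  by apply: measurable_funeM; exact/measurable_EFinP.
- move=> k x _; apply: mule_ge0; last by rewrite lee_fin.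
  exact: nnfun_muleindic_ge0.
(* [k] is a value of [h n], hence nonnegative, and comes out of both integrals. *)
apply: eq_fsbigr => k /[!inE] -[x _ <-].
under [RHS]eq_integral do rewrite -muleA.
rewrite ge0_integralZl_EFin//; last exact/measurable_EFinP.
rewrite integral_indic// setIT nuE//.
rewrite ge0_integralZl_EFin//; last 2 first.
- by move=> y _; rewrite mule_ge0// lee_fin.
- by apply: emeasurable_funM => //; exact/measurable_EFinP.
congr (_ * _); rewrite integral_mkcond; apply: eq_integral => y _.
by rewrite epatch_indic/= muleC.
Qed.

End density.

(** * Factorization of expectations under independence *)

Section independence.
Context {d : measure_display} {T : measurableType d} {R : realType}.
Variable P : probability T R.
Local Open Scope ereal_scope.

(** By independence the joint law of [(X, Y)] agrees with the product of the marginal laws on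
    rectangles, hence everywhere; Fubini then separates the variables. *)
Lemma integral_independentM (X Y : {RV P >-> R}) (g h : R -> R) :
  (forall A B, measurable A -> measurable B ->
    P (X @^-1` A `&` Y @^-1` B) = P (X @^-1` A) * P (Y @^-1` B)) ->
  measurable_fun [set: R] g -> measurable_fun [set: R] h ->
  P.-integrable [set: T] (EFin \o (g \o X)) ->
  P.-integrable [set: T] (EFin \o (h \o Y)) ->
  P.-integrable [set: T] (EFin \o ((g \o X) \* (h \o Y))%R) ->
  \int[P]_w (g (X w) * h (Y w))%:E =
  \int[P]_w (g (X w))%:E * \int[P]_w (h (Y w))%:E.
Proof.
move=> XY mg mh ig ih igh.
have mXY : measurable_fun setT (fun w => (X w, Y w)).
  exact: measurable_fun_pair.
pose Z : {mfun T >-> (R * R)%type} := mfun_Sub (mem_set mXY).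
pose gh z : \bar R := (g z.1 * h z.2)%:E.
have mgh : measurable_fun [set: R * R] gh.
  apply/measurable_EFinP; apply: measurable_funM.
    exact: measurableT_comp.
  exact: measurableT_comp.
have mg' : measurable_fun setT (EFin \o g) by exact/measurable_EFinP.
have mh' : measurable_fun setT (EFin \o h) by exact/measurable_EFinP.
have igX : (distribution P X).-integrable setT (EFin \o g).
  apply/integrableP; split => //.
  rewrite ge0_integral_distribution//; last exact: measurableT_comp.
  by case/integrableP : ig.
have ihY : (distribution P Y).-integrable setT (EFin \o h).
  apply/integrableP; split => //.
  rewrite ge0_integral_distribution//; last exact: measurableT_comp.
  by case/integrableP : ih.
transitivity (\int[distribution P Z]_z gh z).
  by rewrite integral_distribution.
transitivity (\int[distribution P X \x distribution P Y]_z gh z).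
  apply: eq_measure_integral => A mA _; apply/esym.
  by apply: product_measure_unique => // B C mB mC; exact: XY.
(* Fubini asks for integrability under the product law: the iterated integral of the absolute value
   is a product of two finite integrals. *)
rewrite -integral12_prod_meas1; last first.
  apply/integrable12ltyP => //.
  under eq_integral => x _.
    under eq_integral => y _ do rewrite /gh/= normrM EFinM.
    rewrite ge0_integralZl//=; last first.
      by apply: measurableT_comp => //; exact: measurableT_comp.
    over.
  rewrite ge0_integralZr//=; last 2 first.
  - by apply: measurableT_comp => //; exact: measurableT_comp.
  - exact: integral_ge0.
  rewrite lte_mul_pinfty ?integral_ge0//; last by case/integrableP : ihY.
  rewrite ge0_fin_numE ?integral_ge0//; by case/integrableP : igX.
under eq_integral => x _.
  rewrite /fubini_F /gh/=; under eq_integral => y _ do rewrite EFinM.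
  rewrite integralZl//; over.
(* The inner integral is finite, so it can be treated as a real constant and pulled out. *)
rewrite -[X in \int[_]_x (_ * X)]fineK; last exact: integrable_fin_num ihY.
rewrite integralZr// fineK; last exact: integrable_fin_num ihY.
rewrite integral_distribution// [in X in _ * X]integral_distribution//.
Qed.

End independence.

(** * Second moment of an average of centered uncorrelated variables *)

Section second_moment.
Context {d : measure_display} {T : measurableType d} {R : realType}.
Variable P : probability T R.
Local Open Scope ereal_scope.

Lemma expectation_ord_sum n (F : 'I_n -> T -> R) :
  (forall i, F i \in Lfun P 1) ->
  'E_P[fun w => (\sum_(i < n) F i w)%R] = \sum_(i < n) 'E_P[F i].
Proof.
move=> F1; rewrite unlock; under eq_integral do rewrite -sumEFin.
by rewrite integral_sum// => i; exact/Lfun1_integrable.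
Qed.

Lemma Lfun1_ord_sum n (F : 'I_n -> T -> R) :
  (forall i, F i \in Lfun P 1) ->
  (fun w => (\sum_(i < n) F i w)%R) \in Lfun P 1.
Proof.
move=> F1; rewrite [X in X \in _](_ : _ = \sum_(i < n) F i)%R; last first.
  by apply/funext => w; rewrite fct_sumE.
exact: rpred_sum.
Qed.

(** Expand the square: the term linear in the [Z k] has mean zero, and in the double sum only the
    [N] diagonal terms survive, which gives [N v / N ^ 2]. *)
Lemma expectation_sqr_uncorrelated (N : nat) (Z : 'I_N -> T -> R) (a v : R) :
  (0 < N)%N -> (forall k, Z k \in Lfun P 2%:E) ->
  (forall k, 'E_P[Z k] = 0) ->
  (forall k, 'E_P[(Z k \* Z k)%R] = v%:E) ->
  (forall i j, i != j -> 'E_P[(Z i \* Z j)%R] = 0) ->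
  'E_P[fun w => ((a - N%:R^-1 * \sum_(k < N) Z k w) ^+ 2)%R] =
  (a ^+ 2 + v / N%:R)%:E.
Proof.
move=> N0 Z2 EZ EZZ EZ0.
have Pfin : P setT \is a fin_num := fin_num_measure P _ measurableT.
have Z1 k : Z k \in Lfun P 1 by exact: (Lfun_subset12 Pfin).
have ZZ1 i j : (Z i \* Z j)%R \in Lfun P 1 by exact: Lfun2_mul_Lfun1.
(* [B] is the square of [A] written as a double sum, so that linearity of expectation applies to
   it. *)
pose A w := (\sum_(k < N) Z k w)%R.
pose B w := (\sum_(i < N) \sum_(j < N) (Z i \* Z j)%R w)%R.
have A1 : A \in Lfun P 1 by exact: Lfun1_ord_sum.
have B1 : B \in Lfun P 1 by do 2 apply: Lfun1_ord_sum => ?.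
have EA : 'E_P[A] = 0 by rewrite expectation_ord_sum// big1.
have EB : 'E_P[B] = (v *+ N)%:E.
  rewrite expectation_ord_sum; last by move=> i; exact: Lfun1_ord_sum.
  rewrite (eq_bigr (fun=> v%:E)); last first.
    move=> i _; rewrite expectation_ord_sum// (bigD1 i)//= EZZ big1 ?adde0//.
    by move=> j ji; rewrite EZ0// eq_sym.
  by rewrite sumEFin sumr_const card_ord.
rewrite (_ : (fun w => _) = (cst (a ^+ 2) \+ ((- 2 * a / N%:R) \o* A \+
    (N%:R ^- 2) \o* B))%R); last first.
  apply/funext => w /=; have -> : B w = (A w ^+ 2)%R.
    rewrite expr2 mulr_suml; apply: eq_bigr => i _.
    by rewrite mulr_sumr.
  by rewrite -/(A w) -exprVn; ring.
rewrite expectationD ?Lfun_cst//; last first.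
  by rewrite rpredD// Lfun_scale.
rewrite expectation_cst expectationD ?Lfun_scale// !expectationZl// EA EB.
rewrite mule0 add0e -EFinM -EFinD; congr ((_ + _)%:E).
by rewrite -mulr_natr; field; rewrite pnatr_eq0 -lt0n.
Qed.

End second_moment.

Lemma Lfun2_sqr_lty {d : measure_display} {T : measurableType d} {R : realType}
    (mu : {measure set T -> \bar R}) (f : T -> R) :
  measurable_fun [set: T] f ->
  (\int[mu]_x (f x ^+ 2)%:E < +oo)%E -> f \in Lfun mu 2%:E.
Proof.
move=> mf f2; rewrite inE; apply/andP; split; rewrite inE//=.
rewrite /finite_norm unlock poweR_lty//.
rewrite (eq_integral (fun x => (f x ^+ 2)%:E))// => x _.
by rewrite /= powR_mulrn// real_normK ?num_real.
Qed.

(** After squaring, the two sides differ by the nonnegative cross term of the right-hand side. *)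
Lemma sqrt_sqrD_le {R : realType} (a v c : R) : 0 <= v -> 0 < c ->
  Num.sqrt (a ^+ 2 + v / c) <= `|a| + Num.sqrt v / Num.sqrt c.
Proof.
move=> v0 c0; have sc : 0 < Num.sqrt c by rewrite sqrtr_gt0.
rewrite -[leRHS]ger0_norm ?addr_ge0 ?divr_ge0 ?sqrtr_ge0//.
rewrite -sqrtr_sqr ler_sqrt ?sqr_ge0// sqrrD.
rewrite real_normK ?num_real// expr_div_n !sqr_sqrtr ?(ltW c0)//.
by rewrite lerD2r lerDl mulrn_wge0// mulr_ge0// divr_ge0 ?sqrtr_ge0.
Qed.

(** * Random variables with a density on [D] *)

Section density_on.
Context {R : realType} {d : measure_display} {T : measurableType d}.
Variables (P : probability T R) (D : set R) (f : R -> R).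
Hypothesis mD : measurable D.
Hypothesis hf : probability_density D f.

Lemma measurable_density_patch : measurable_fun [set: R] (f \_ D).
Proof. by case: hf => mf _ _; apply/(measurable_restrictT f mD). Qed.

Lemma density_patch_ge0 x : 0 <= (f \_ D) x.
Proof.
by case: hf => _ f0 _; rewrite patchE; case: ifPn => // /[!inE]; exact: f0.
Qed.

Lemma integral_density_patch (phi : R -> \bar R) :
  (\int[lebesgue_measure]_(y in D) (phi y * (f y)%:E) =
   \int[lebesgue_measure]_y (phi y * ((f \_ D) y)%:E))%E.
Proof.
rewrite integral_mkcond; apply: eq_integral => y _.
by rewrite !patchE; case: ifPn => //; rewrite mule0.
Qed.

(** The law of [X] has the density [f \_ D] on the whole line. Nonnegativity of [phi] replaces
    integrability, so the formula can itself be used to prove that moments are finite. *)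
Lemma ge0_integral_has_density (X : {RV P >-> R}) (phi : R -> R) :
  has_density D f X -> measurable_fun [set: R] phi -> (forall y, 0 <= phi y) ->
  (\int[P]_w (phi (X w))%:E =
   \int[lebesgue_measure]_(y in D) (phi y * f y)%:E)%E.
Proof.
move=> Xf mphi phi0.
(* lebesgue_measure lives on measurableTypeR R, whose display differs from that
   of R although the measurable sets are the same. *)
have mX : measurable_fun [set: T] (X : T -> measurableTypeR R).
  exact: (measurable_funPT X).
pose Y : {mfun T >-> measurableTypeR R} := 
  @mfun_Sub _ _ T (measurableTypeR R) X (mem_set mX).
have mphi' : measurable_fun [set: measurableTypeR R] (EFin \o phi).
  exact/measurable_EFinP.
under [RHS]eq_integral do rewrite EFinM.
rewrite integral_density_patch.
rewrite -(ge0_integral_density _ (distribution P Y))//.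
- by rewrite ge0_integral_distribution// => y; rewrite lee_fin.
- exact: measurable_density_patch.
- exact: density_patch_ge0.
- move=> A mA; transitivity (distribution P X A) => //.
  rewrite Xf// integral_mkcondr; apply: eq_integral => y _.
  by rewrite !patchE; case: ifPn.
Qed.

End density_on.

(** * Mean square error at a fixed point *)

Section pointwise.
Context {R : realType} {d : measure_display} {T : measurableType d}.
Variables (P : probability T R) (D : set R) (f s : R -> R).
Variables (N : nat) (X : 'I_N -> {RV P >-> R}).
Hypothesis mD : measurable D.
Hypothesis hf : probability_density D f.
Hypothesis ms : measurable_fun [set: R] s.
Hypothesis s0 : forall y, 0 <= s y.
Hypothesis N0 : (0 < N)%N.
Hypothesis hX : forall k, has_density D f (X k).
Hypothesis indepX : mutually_independent X.

Lemma mutually_independent_pair (i j : 'I_N) (A B : set R) : i != j ->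
  measurable A -> measurable B ->
  (P (X i @^-1` A `&` X j @^-1` B) = P (X i @^-1` A) * P (X j @^-1` B))%E.
Proof.
move=> ij mA mB; have ji : j != i by rewrite eq_sym.
(* Values of [C] at indices other than [i] and [j] do not matter, as independence is applied to the
   index set [{i, j}]. *)
pose C k := if k == i then A else B.
have mC k : measurable (C k) by rewrite /C; case: ifP.
have := indepX [set i; j]%SET C mC.
rewrite big_setU1 ?inE//= big_set1 /C eqxx (negbTE ji) => <-.
congr (P _); apply/seteqP; split => w /=.
- by move=> [Xi Xj] k /=; rewrite !inE => /orP[] /eqP ->;
    rewrite ?eqxx ?(negbTE ji).
- move=> h; split.
    by have := h i; rewrite /= !inE !eqxx; exact.
  by have := h j; rewrite /= !inE eqxx orbT (negbTE ji); exact.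
Qed.

Lemma measurable_shift x : measurable_fun [set: R] (fun y => s (x - y)).
Proof. by apply: measurableT_comp => //; exact: measurable_funB. Qed.

Lemma smoothed_density_ge0 x : (0 <= smoothed_density D s f x)%E.
Proof.
case: hf => _ f0 _; apply: integral_ge0 => y Dy.
by rewrite lee_fin mulr_ge0// f0.
Qed.

Lemma sigma2_ge0 x : (0 <= sigma2 D s f x)%E.
Proof.
case: hf => _ f0 _; apply: integral_ge0 => y Dy.
by rewrite mule_ge0 ?sqre_ge0// lee_fin f0.
Qed.

(* When the smoothed density or sigma2 is infinite at x, so is the right-hand
   side. *)
Lemma sqrt_mse_le (x u0 : R) :
  (sqrte 'E_P[fun w => ((u0 - empirical_density s X x w) ^+ 2)%R] <=
   (Num.sqrt N%:R)^-1%:E * sigma D s f x +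
   `|u0%:E - smoothed_density D s f x|)%E.
Proof.
have NR0 : 0 < N%:R :> R by rewrite ltr0n.
have sN0 : 0 < Num.sqrt N%:R :> R by rewrite sqrtr_gt0.
have sig0 : (0 <= (Num.sqrt N%:R)^-1%:E * sigma D s f x)%E.
  by rewrite mule_ge0 ?sqrte_ge0// lee_fin invr_ge0 ltW.
have := smoothed_density_ge0 x.
case mE : (smoothed_density D s f x) => [m| |//] m0; last first.
  by rewrite /= addey ?leey// gt_eqF// (lt_le_trans _ sig0).
have := sigma2_ge0 x; rewrite /sigma.
case vE : (sigma2 D s f x) => [v| |//] v0; last first.
  by rewrite /= gt0_muley ?lte_fin ?invr_gt0// addye ?leey// gt_eqF.
rewrite lee_fin in v0.
(* The kernel centered at its mean, so that the variables [Z k] below have mean zero and variance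
   [v]. *)
pose g y := s (x - y) - m.
have mg : measurable_fun [set: R] g.
  by apply: measurable_funB => //; exact: measurable_shift.
pose Z k w := g (X k w).
have mZ k : measurable_fun setT (Z k) by exact: measurableT_comp.
(* The square is nonnegative, so its expectation is available before integrability is known;
   finiteness of [v] then puts [Z k] in [L^2], hence in [L^1]. *)
have Zsqr k : (\int[P]_w (Z k w ^+ 2)%:E = v%:E)%E.
  rewrite (ge0_integral_has_density _ _ _ mD hf _ (fun y => g y ^+ 2))//.
  - rewrite -vE; apply: eq_integral => y _.
    by rewrite mE /g -EFinB expe2 -!EFinM.
  - by apply: measurable_funX.
  - by move=> y; exact: sqr_ge0.
have Z2 k : Z k \in Lfun P 2%:E.
  by apply: Lfun2_sqr_lty => //; rewrite Zsqr ltry.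
have Pfin : P setT \is a fin_num := fin_num_measure P _ measurableT.
have Z1 k : Z k \in Lfun P 1 by exact: (Lfun_subset12 Pfin).
have Zint k : P.-integrable [set: T] (EFin \o Z k) by exact/Lfun1_integrable.
have ZE k : ('E_P[Z k] = 0)%E.
  (* The transfer formula covers [s (x - y)], which is nonnegative, but not the signed [g]; hence
     [m] is split off, with integrability inherited from [Z k]. *)
  have S1 : (fun w => s (x - X k w)) \in Lfun P 1.
    rewrite [X in X \in _](_ : _ = Z k \+ cst m).
      by rewrite rpredD// Lfun_cst.
    by apply/funext => w /=; rewrite /Z /g subrK.
  rewrite [X in 'E_P[X]%E](_ : _ = (fun w => s (x - X k w)) \- cst m)//.
  rewrite expectationB ?Lfun_cst// expectation_cst unlock.
  rewrite (ge0_integral_has_density _ _ _ mD hf _ (fun y => s (x - y)))//;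
    last exact: measurable_shift.
  by rewrite -/(smoothed_density _ _ _ _) mE subee.
have ZZE k : ('E_P[(Z k \* Z k)%R] = v%:E)%E by rewrite unlock -(Zsqr k).
have ZiZj i j : i != j -> ('E_P[(Z i \* Z j)%R] = 0)%E.
  move=> ij; rewrite unlock (integral_independentM _ (X i) (X j) g g)//.
  - by have := ZE i; rewrite unlock => ->; rewrite mul0e.
  - by move=> A B mA mB; exact: mutually_independent_pair.
  - exact: Zint.
  - exact: Zint.
  - by apply/(Lfun1_integrable P (Z i \* Z j)); exact: Lfun2_mul_Lfun1.
(* Bias minus fluctuation: averaging the [N] copies of [m] hidden in the [Z k] returns [m]. *)
rewrite [X in 'E_P[X]%E](_ : _ =
    fun w => ((u0 - m) - N%:R^-1 * \sum_(k < N) Z k w) ^+ 2); last first.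
  apply/funext => w; congr (_ ^+ 2); rewrite /empirical_density.
  rewrite /Z /g sumrB sumr_const card_ord mulrBr -[m *+ N]mulr_natl.
  rewrite mulKf ?gt_eqF//.
  by rewrite opprB addrA subrK.
rewrite (expectation_sqr_uncorrelated _ _ _ _ v)//=.
rewrite lee_fin (le_trans (sqrt_sqrD_le _ _ _ v0 NR0))//.
by rewrite addrC lerD2l mulrC.
Qed.

End pointwise.

(** On nonnegative values the square root is the power [1/2], and powers are measurable. *)
Lemma ge0_measurable_sqrte {d : measure_display} {T : measurableType d}
    {R : realType} (g : T -> \bar R) :
  measurable_fun [set: T] g -> (forall x, (0 <= g x)%E) ->
  measurable_fun [set: T] (fun x => sqrte (g x)).
Proof.
move=> mg g0; rewrite (_ : (fun x => sqrte (g x)) = fun x => (g x `^ 2^-1)%E).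
  exact: (measurableT_comp (measurable_poweR _)).
by apply/funext => x; rewrite poweR12_sqrt.
Qed.

(** * Measurability in [x] of the functions whose norms are compared *)

Section measurability.
Context {R : realType}.
Variables (D : set R) (f s : R -> R).
Hypothesis mD : measurable D.
Hypothesis hf : probability_density D f.
Hypothesis ms : measurable_fun [set: R] s.
Hypothesis s0 : forall y, 0 <= s y.
(** The integration variable ranges over the type that carries [lebesgue_measure]. *)
Let B := measurableTypeR R.

Let mkernel : measurable_fun [set: R * B] (fun z : R * B => s (z.1 - z.2)).
Proof.
apply: measurableT_comp => //; apply: measurable_funB.
  exact: measurable_fst.
exact: (measurable_snd : measurable_fun [set: R * B] snd).
Qed.

Let mdensity : measurable_fun [set: R * B] (fun z : R * B => (f \_ D) z.2).
Proof.
apply: (@measurableT_comp _ _ _ (R * B)%type B R (f \_ D) _ snd).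
  exact: measurable_density_patch _ _ mD hf.
exact: measurable_snd.
Qed.

(** Tonelli: a partial integral of a nonnegative jointly measurable kernel is measurable in the
    remaining variable. *)
Lemma measurable_smoothed_density :
  measurable_fun [set: R] (smoothed_density D s f).
Proof.
rewrite (_ : smoothed_density D s f = fubini_F lebesgue_measure
    (fun z : R * B => (s (z.1 - z.2) * (f \_ D) z.2)%:E)).
  apply: measurable_fun_fubini_tonelli_F.
    by apply/measurable_EFinP; exact: measurable_funM.
  by move=> z; rewrite lee_fin mulr_ge0// (density_patch_ge0 _ _ hf).
apply/funext => x; rewrite /smoothed_density /fubini_F/=.
under eq_integral do rewrite EFinM.
by rewrite integral_density_patch; under eq_integral do rewrite -EFinM.
Qed.

(** Again Tonelli; the integrand also depends on [x] through the smoothed density, whose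
    measurability is already known. *)
Lemma measurable_sigma2 : measurable_fun [set: R] (sigma2 D s f).
Proof.
rewrite (_ : sigma2 D s f = fubini_F lebesgue_measure (fun z : R * B =>
    ((s (z.1 - z.2))%:E - smoothed_density D s f z.1) ^+ 2 *
    ((f \_ D) z.2)%:E)%E).
  apply: measurable_fun_fubini_tonelli_F.
    apply: emeasurable_funM; last exact/measurable_EFinP.
    under eq_fun do rewrite expe2.
    have h : measurable_fun [set: R * B] (fun z : R * B =>
        (s (z.1 - z.2))%:E - smoothed_density D s f z.1)%E.
      apply: emeasurable_funB; first exact/measurable_EFinP.
      by apply: measurableT_comp => //; exact: measurable_smoothed_density.
    exact: emeasurable_funM.
  by move=> z; rewrite mule_ge0 ?sqre_ge0// lee_fin (density_patch_ge0 _ _ hf).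
by apply/funext => x; rewrite /sigma2 /fubini_F/= integral_density_patch.
Qed.

Lemma measurable_sigma : measurable_fun [set: R] (sigma D s f).
Proof.
apply: ge0_measurable_sqrte; first exact: measurable_sigma2.
exact: sigma2_ge0.
Qed.

Lemma measurable_root_mse {d : measure_display} {T : measurableType d}
    (P : probability T R) (N : nat) (X : 'I_N -> {RV P >-> R}) :
  measurable_fun D (fun x =>
    sqrte 'E_P[fun w => ((f x - empirical_density s X x w) ^+ 2)%R]%E).
Proof.
(* Outside [D] nothing is known about [f], so it is replaced by its extension by 0, which changes
   nothing on [D]. *)
pose k (z : R * T) := (((f \_ D) z.1 - empirical_density s X z.1 z.2) ^+ 2)%:E.
apply: (eq_measurable_fun (fun x => sqrte (fubini_F P k x))).
  move=> x xD; rewrite unlock /fubini_F /k/=; congr sqrte.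
  by apply: eq_integral => w _; rewrite patchE xD.
apply: measurable_funTS; apply: ge0_measurable_sqrte; last first.
  by move=> x; apply: integral_ge0 => w _; rewrite lee_fin sqr_ge0.
apply: measurable_fun_fubini_tonelli_F; last first.
  by move=> z; rewrite lee_fin sqr_ge0.
apply/measurable_EFinP; apply: measurable_funX; apply: measurable_funB.
  by apply: measurableT_comp => //; exact: measurable_density_patch.
apply: measurable_funM => //; apply: measurable_sum => i.
apply: measurableT_comp => //; apply: measurable_funB => //.
by apply: measurableT_comp.
Qed.

End measurability.

Theorem theorem1 (R : realType) (Omega : set R) (p : \bar R)
    (u : R -> R -> R) (t : R) (dx : R) (Sdx : R -> R) (q : nat) (Cq : R)
    (d : measure_display) (T : measurableType d) (P : probability T R)
    (N : nat) (X : 'I_N -> {RV P >-> R})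
    (hOmega : is_domain Omega)
    (hp : (1 <= p)%E)
    (hu : probability_density Omega (u ^~ t))
    (hdx : 0 < dx)
    (hSmeas : measurable_fun [set: R] Sdx)
    (hS0 : forall x : R, 0 <= Sdx x)
    (hS1 : (\int[lebesgue_measure]_(x in Omega) (Sdx x)%:E = 1)%E)
    (hN : (0 < N)%N)
    (hXdens : forall k : 'I_N, has_density Omega (u ^~ t) (X k))
    (hXindep : mutually_independent X)
    (hq : (1 <= q)%N)
    (husmooth : times_derivable Omega q (u ^~ t))
    (hacc : (LpNorm Omega p
               (fun x => (u x t)%:E - smoothed_density Omega Sdx (u ^~ t) x)
             <= (Cq * dx ^+ q)%:E)%E) :
  (mixedNorm P Omega p
     (fun (x : R) (w : T) => (u x t - empirical_density Sdx X x w)%R)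
   <= LpNorm Omega p (sigma Omega Sdx (u ^~ t)) / (Num.sqrt (N%:R : R))%:E
      + (Cq * dx ^+ q)%:E)%E.
Proof.
have mO : measurable Omega by case: hOmega => _ oO _; exact: open_measurable.
have [mf _ _] := hu.
set f := u ^~ t; pose c : R := (Num.sqrt N%:R)^-1.
have sN0 : 0 < Num.sqrt N%:R :> R by rewrite sqrtr_gt0 ltr0n.
have c0 : 0 < c by rewrite invr_gt0.
rewrite /mixedNorm /LpNorm.
set rmse := (X in Lnorm _ _ (X \_ _)).
pose bias x := ((f x)%:E - smoothed_density Omega Sdx f x)%E.
set sig := sigma Omega Sdx f.
have restrict_measurable (h : R -> \bar R) : measurable_fun Omega h ->
    measurable_fun [set: R] (h \_ Omega).
  by move=> mh; apply/(measurable_restrictT h mO).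
have m_rmse : measurable_fun [set: R] (rmse \_ Omega).
  apply: restrict_measurable.
  exact: (@measurable_root_mse _ _ _ _ mO hu hSmeas _ _ P).
have m_sig : measurable_fun [set: R] (sig \_ Omega).
  apply: restrict_measurable; apply: measurable_funTS.
  exact: (measurable_sigma _ _ _ mO hu hSmeas hS0).
have m_bias : measurable_fun [set: R] (bias \_ Omega).
  apply: restrict_measurable; apply: emeasurable_funB.
    exact/measurable_EFinP.
  apply: measurable_funTS.
  exact: (measurable_smoothed_density _ _ _ mO hu hSmeas hS0).
have m_csig : measurable_fun [set: R] (fun x => c%:E * (sig \_ Omega) x)%E.
  exact: measurable_funeM.
have m_abias : measurable_fun [set: R] (abse \o (bias \_ Omega)).
  exact: measurableT_comp.
(* The pointwise bound holds on [Omega], and outside it both functions vanish. *)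
apply: (@le_trans _ _ ('N[lebesgue_measure]_p[
    (fun x => c%:E * (sig \_ Omega) x) \+ (abse \o (bias \_ Omega))])%E).
  apply: le_Lnorm => //; first exact: emeasurable_funD.
  move=> x; rewrite /= !patchE; case: ifPn => [/[!inE] Ox|_].
    rewrite gee0_abs ?sqrte_ge0//.
    rewrite (le_trans _ (lee_abs _))//; exact: sqrt_mse_le.
  by rewrite mule0 abse0 adde0 abse0.
apply: le_trans; first exact: Lnorm_triangle.
(* The norm ignores the absolute value, so the bias term is exactly the accuracy hypothesis. *)
apply: leeD; last by rewrite Lnorm_abse; exact: hacc.
rewrite LnormZ_pos// muleC.
(* The extended-real inverse of a nonzero real is its real inverse, which identifies [c] with the
   division in the statement. *)
by rewrite inver gt_eqF.
Qed.
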